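(* Let $\mathcal{M}$ be a matroid on a finite set $X$ with bases $\mathcal{B}$, and let $f:2^X\to\mathbb{R}_{\ge0}$ be nonnegative submodular, such that the instance $\max\{f(S):S\in\mathcal{B}\}$ is totally symmetric with respect to a group $\mathcal{G}$ of permutations of $X$, with center $\mathbf{c}$. Let $\nu$ be the fractional packing number of bases of $\mathcal{M}$ and $\nu^*$ the fractional packing number of bases of the dual matroid (complements of bases). Then $$F(\mathbf{c})\ge\left(1-\frac{1}{2\nu}-\frac{1}{2\nu^*}\right)OPT,$$ where $F$ is the multilinear extension of $f$ and $OPT=\max\{f(S):S\in\mathcal{B}\}$.
   Context: The multilinear extension is $F(\mathbf{x})=\sum_{S\subseteq X}f(S)\prod_{i\in S}x_i\prod_{j\notin S}(1-x_j)$. For a family $\mathcal{F}\subseteq 2^X$, $P(\mathcal{F})=\mathrm{conv}\{\mathbf{1}_S:S\in\mathcal{F}\}$; $\sigma(\mathbf{x})$ is $\mathbf{x}$ with coordinates permuted by $\sigma$. An instance $\max\{f(S):S\in\mathcal{F}\}$ is totally symmetric with respect to $\mathcal{G}$ if $f$ and $\mathcal{F}$ are invariant under $\mathcal{G}$ ($f(\sigma(S))=f(S)$, $S\in\mathcal{F}\Leftrightarrow\sigma(S)\in\mathcal{F}$) and there is a point $\mathbf{c}\in P(\mathcal{F})$ with $\mathbf{c}=\mathbf{E}_{\sigma\in\mathcal{G}}[\sigma(\mathbf{x})]$ (uniform $\sigma$) for every $\mathbf{x}\in P(\mathcal{F})$; $\mathbf{c}$ is the center. The fractional packing number of a family of sets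 $\mathcal{B}$ is $\max\sum_{B}\alpha_B$ over $\alpha_B\ge0$ with $\sum_{B\ni j}\alpha_B\le1$ for every element $j$. *)

(* Defs.v *)
From HB Require Import structures.
From mathcomp Require Import all_boot all_order all_algebra all_fingroup.
From mathcomp Require Import all_classical all_reals ereal.
(* Reimported last, so that set0, setC, subset_trans, ... refer to {set T}. *)
From mathcomp Require Import fintype finset.

Set Implicit Arguments.
Unset Strict Implicit.
Unset Printing Implicit Defensive.

Import Order.TTheory GRing.Theory Num.Theory.
Local Open Scope ring_scope.

Record matroid (X : finType) := Matroid {
  indep : {set {set X}};
  indep0 : set0 \in indep;
  indep_sub : forall I J : {set X}, I \subset J -> J \in indep -> I \in indep;
  indep_aug : forall I J : {set X}, I \in indep -> J \in indep ->
    (#|I| < #|J|)%N -> exists2 x, x \in J :\: I & x |: I \in indep }.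

Definition bases (X : finType) (M : matroid X) : {set {set X}} :=
  [set B | maxset (fun I => I \in indep M) B].

Section Dual.
Context {X : finType} (M : matroid X).
Implicit Types I J B : {set X}.

Lemma bases_indep B : B \in bases M -> B \in indep M.
Proof. by rewrite inE => /maxsetp. Qed.

Lemma indep_bases_ex I : I \in indep M -> exists2 B, B \in bases M & I \subset B.
Proof.
move=> iI; have [B mB IB] := @maxset_exists _ (fun I => I \in indep M) I iI.
by exists B => //; rewrite inE.
Qed.

Lemma leq_card_base I B : I \in indep M -> B \in bases M -> (#|I| <= #|B|)%N.
Proof.
move=> iI bB; rewrite leqNgt; apply/negP => ltBI.
have [x] := indep_aug (bases_indep bB) iI ltBI.
rewrite inE => /andP[xB _] ixB; move: bB; rewrite inE => /maxsetP[_ mB].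
by move: xB; rewrite -(mB _ ixB (subsetUr _ _)) setU11.
Qed.

Lemma bases_card B B' : B \in bases M -> B' \in bases M -> #|B| = #|B'|.
Proof.
move=> bB bB'; apply/eqP.
by rewrite eqn_leq !leq_card_base // bases_indep.
Qed.

Lemma card_bases I B :
  I \in indep M -> B \in bases M -> #|I| = #|B| -> I \in bases M.
Proof.
move=> iI bB cI; rewrite inE; apply/maxsetP; split=> // J iJ IJ.
by apply/esym/eqP; rewrite eqEcard IJ cI leq_card_base.
Qed.

Lemma indep_extend I B : I \in indep M -> B \in bases M ->
  exists B', [/\ B' \in bases M, I \subset B' & B' \subset I :|: B].
Proof.
move=> iI bB.
pose P J := (J \in indep M) && (J \subset I :|: B).
have PI : P I by rewrite /P iI subsetUl.
have [B' /maxsetP[/andP[iB' sB'] mB'] IB'] := @maxset_exists _ P I PI.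
exists B'; split=> //; apply: (card_bases iB' bB).
apply/eqP; rewrite eqn_leq (leq_card_base iB' bB) /= leqNgt; apply/negP => ltB'B.
have [x] := indep_aug iB' (bases_indep bB) ltB'B.
rewrite inE => /andP[xB' xB] ixB'.
have PxB' : P (x |: B').
  by rewrite /P ixB' subUset sub1set inE xB orbT.
by move: xB'; rewrite -(mB' _ PxB' (subsetUr _ _)) setU11.
Qed.

Definition dual_indep : {set {set X}} :=
  [set I : {set X} | [exists B in bases M, I \subset ~: B]].

Lemma dual_indepP I :
  reflect (exists2 B, B \in bases M & I \subset ~: B) (I \in dual_indep).
Proof. by rewrite inE; apply: exists_inP. Qed.

Lemma dual_indep0 : set0 \in dual_indep.
Proof.
have [B bB _] := indep_bases_ex (indep0 M).
by apply/dual_indepP; exists B; rewrite ?sub0set.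
Qed.

Lemma dual_indep_sub I J : I \subset J -> J \in dual_indep -> I \in dual_indep.
Proof.
move=> IJ /dual_indepP[B bB JB]; apply/dual_indepP.
by exists B => //; apply: subset_trans JB.
Qed.

Lemma dual_indep_aug I J : I \in dual_indep -> J \in dual_indep ->
  (#|I| < #|J|)%N -> exists2 x, x \in J :\: I & x |: I \in dual_indep.
Proof.
move=> /dual_indepP[B bB IB] /dual_indepP[B' bB' JB'] ltIJ.
have iB'I : B' :\: I \in indep M := indep_sub (subsetDl _ _) (bases_indep bB').
have [C [bC B'C CB]] := indep_extend iB'I bB.
have IC : I \subset ~: C.
  apply/subsetP => x xI; rewrite inE; apply/negP => /(subsetP CB).
  by have := subsetP IB x xI; rewrite !inE xI => /negbTE ->.
have [JC|/subsetPn[x xJ xC]] := boolP (J :\: I \subset C); last first.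
  exists x => //; apply/dual_indepP; exists C => //.
  by rewrite subUset sub1set inE xC IC.
exfalso.
have dJB' : [disjoint J & B'] by rewrite disjoints_subset.
have disj1 : (J :\: I) :&: (B' :\: I) = set0.
  apply/setP => y; rewrite !inE; apply/negP => /andP[/andP[_ yJ] /andP[_ yB']].
  by have := subsetP JB' y yJ; rewrite inE yB'.
have disj2 : (J :&: I) :&: (B' :&: I) = set0.
  apply/setP => y; rewrite !inE; apply/negP => /andP[/andP[yJ _] /andP[yB' _]].
  by have := subsetP JB' y yJ; rewrite inE yB'.
have le1 : (#|J :\: I| + #|B' :\: I| <= #|B'|)%N.
  rewrite -(bases_card bC bB') -cardsUI disj1 cards0 addn0.
  by apply: subset_leq_card; rewrite subUset JC B'C.
have le2 : (#|J :&: I| + #|B' :&: I| <= #|I|)%N.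
  rewrite -cardsUI disj2 cards0 addn0.
  by apply: subset_leq_card; rewrite subUset !subsetIr.
have := leq_add le2 le1.
by rewrite addnACA !cardsID leq_add2r leqNgt ltIJ.
Qed.

Definition dual_matroid : matroid X :=
  Matroid dual_indep0 dual_indep_sub dual_indep_aug.

Lemma bases_dual : bases dual_matroid = [set ~: B | B in bases M].
Proof.
apply/setP => C; rewrite inE; apply/maxsetP/imsetP.
  move=> [/dual_indepP[B bB CB] mC]; exists B => //; apply/esym/mC => //.
  by apply/dual_indepP; exists B.
move=> [B bB ->]; split; first by apply/dual_indepP; exists B.
move=> D /dual_indepP[B' bB' DB'] BD; apply/eqP.
rewrite eqEsubset BD andbT -[D]setCK setCS.
have B'D : B' \subset ~: D by rewrite -[B']setCK setCS.
have DB : ~: D \subset B by rewrite -[B]setCK setCS.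
suff /eqP <- : B' == B by [].
by rewrite eqEcard (subset_trans B'D DB) (bases_card bB bB') leqnn.
Qed.

End Dual.

Section Symmetry.
Context {R : realType} {X : finType}.
Implicit Types (f : {set X} -> R) (F : {set {set X}}) (G : {group {perm X}}).
Implicit Types (x c : X -> R).

Definition submodular f : Prop :=
  forall S T : {set X}, f (S :|: T) + f (S :&: T) <= f S + f T.

Definition multilinear f x : R :=
  \sum_(S : {set X}) f S * (\prod_(i in S) x i) * \prod_(j in ~: S) (1 - x j).

Definition indicator (S : {set X}) : X -> R := fun i => (i \in S)%:R.

Definition in_polytope F x : Prop :=
  exists lam : {set X} -> R,
    [/\ forall S, S \in F -> 0 <= lam S,
        \sum_(S in F) lam S = 1
      & forall i, x i = \sum_(S in F) lam S * indicator S i].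

(* The inverse makes the action agree with the one on sets:
   permute_point s (indicator S) = indicator (s @: S). *)
Definition permute_point (s : {perm X}) x : X -> R := fun i => x ((s^-1)%g i).

Lemma permute_indicator (s : {perm X}) (S : {set X}) :
  permute_point s (indicator S) =1 indicator (s @: S).
Proof.
by move=> i; rewrite /permute_point /indicator -{2}(permKV s i) (mem_imset _ _ perm_inj).
Qed.

Definition symmetrization G x : X -> R :=
  fun i => #|G|%:R^-1 * \sum_(s in G) permute_point s x i.

Record totally_symmetric f F G c : Prop := TotallySymmetric {
  objective_invariant : forall (s : {perm X}) (S : {set X}),
    s \in G -> f (s @: S) = f S;
  family_invariant : forall (s : {perm X}) (S : {set X}),
    s \in G -> (S \in F) = (s @: S \in F);
  center_in_polytope : in_polytope F c;
  center_symmetrization : forall x, in_polytope F x -> c =1 symmetrization G x }.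

(* The initial value 0 is harmless: this is only used for f >= 0, F nonempty. *)
Definition OPT f F : R := \big[Num.max/0]_(S in F) f S.

End Symmetry.

Section FractionalPacking.
Context (R : realType) {X : finType}.
Implicit Types (F : {set {set X}}) (alpha : {set X} -> R).

Definition fractional_packing F alpha : Prop :=
  (forall B, B \in F -> 0 <= alpha B) /\
  (forall j : X, \sum_(B in F | j \in B) alpha B <= 1).

(* Extended-real valued: the linear program is unbounded, and the value +oo,
   exactly when the empty set belongs to F (for bases: a matroid of rank 0). *)
Definition fractional_packing_number F : \bar R :=
  ereal_sup [set (\sum_(B in F) alpha B)%:E | alpha in fractional_packing F]%classic.

Lemma fractional_packing_number_max F alpha :
  fractional_packing F alpha ->
  (forall beta, fractional_packing F beta ->
     \sum_(B in F) beta B <= \sum_(B in F) alpha B) ->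
  fractional_packing_number F = (\sum_(B in F) alpha B)%:E.
Proof.
move=> pa maxa; apply/eqP; rewrite eq_le; apply/andP; split.
  by apply: ge_ereal_sup => _ [beta pb <-]; rewrite lee_fin maxa.
by apply: ereal_sup_ubound; exists alpha.
Qed.

End FractionalPacking.

(* Main.v *)
(** Let A be the random set containing each i independently with probability
    c_i, let O be an optimal basis, and let d_i be the partial derivatives of F
    at c.  Telescoping f along O :\: A and along A :\: O gives, by submodularity,
    E f(O :|: A) + E f(O :&: A) <= 2 F(c) + sum_i (1_O - c)_i d_i.
    The d_i are constant on the orbits of G, and c is the average of the images
    of 1_O under G, so the last sum vanishes.  Averaging a packing of bases over
    G shows c_i <= 1/nu, and dually 1 - c_i <= 1/nustar.  So A contains each
    element with probability at most 1/nu, which costs at most a factor 1 - 1/nu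
    in E f(O :|: A) against f(O); likewise E f(O :&: A) >= (1 - 1/nustar) f(O). *)

Require Import Defs.
From mathcomp Require Import all_boot all_order all_algebra all_fingroup.
From mathcomp Require Import all_classical all_reals ereal.
From mathcomp Require Import fintype finset.
From mathcomp Require Import lra.

Set Implicit Arguments.
Unset Strict Implicit.
Unset Printing Implicit Defensive.

Import Order.TTheory GRing.Theory Num.Theory.
Local Open Scope ring_scope.

(** * Expectations when each element is sampled independently *)

Section ProductDistribution.
Context {R : realType} {X : finType}.
Implicit Types (f g : {set X} -> R) (x : X -> R) (S : {set X}).

Definition product_weight x S : R := \prod_i (if i \in S then x i else 1 - x i).

Lemma multilinearE f x : multilinear f x = \sum_S product_weight x S * f S.
Proof.
apply: eq_bigr => S _; rewrite -mulrA mulrC; congr (_ * _).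
rewrite /product_weight [RHS](bigID (mem S)) /=; congr (_ * _).
  by apply: eq_bigr => i ->.
by apply: eq_big => [i|i]; rewrite inE // => /negbTE ->.
Qed.

Lemma sum_product_weight x : \sum_S product_weight x S = 1.
Proof.
have := bigA_distr 1 (GRing.add : Monoid.add_law 0 *%R) x (fun i => 1 - x i).
by rewrite /= big1 => [->|i _] //; rewrite addrC subrK.
Qed.

Lemma product_weight_ge0 x S :
  (forall i, 0 <= x i) -> (forall i, x i <= 1) -> 0 <= product_weight x S.
Proof. by move=> x0 x1; apply: prodr_ge0 => i _; case: ifP; rewrite ?subr_ge0. Qed.

Lemma product_weightU1 x S i : i \notin S ->
  (1 - x i) * product_weight x (i |: S) = x i * product_weight x S.
Proof.
move=> iS; rewrite /product_weight (bigD1 i) //= [in RHS](bigD1 i) //=.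
rewrite setU11 (negbTE iS) mulrCA; congr (_ * (_ * _)).
by apply: eq_bigr => j /negbTE ji; rewrite in_setU1 ji.
Qed.

(** The hypothesis says that [g] ignores [i], so [g S] is independent of the event [i \in S].
    Pairing [S] with [i |: S] relates the parts with and without [i] by [(1 - x i) * A = x i * B], a
    division-free form that covers [x i] equal to 0 or 1. *)
Lemma sum_product_weight_mem x i g : (forall S, g (i |: S) = g (S :\ i)) ->
  \sum_(S : {set X} | i \in S) product_weight x S * g S =
  x i * \sum_S product_weight x S * g S.
Proof.
move=> gi; set A := LHS; pose B := \sum_(S : {set X} | i \notin S) product_weight x S * g S.
have -> : \sum_S product_weight x S * g S = A + B by rewrite [LHS](bigID (fun S : {set X} => i \in S)).
suff AB : (1 - x i) * A = x i * B.
  by rewrite mulrDr -AB -mulrDl addrC subrK mul1r.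
rewrite /A (reindex_onto (fun S : {set X} => i |: S) (fun S => S :\ i)) /=; last first.
  by move=> S; apply: setD1K.
rewrite !mulr_sumr; apply: eq_big => [S|S /andP[_ /eqP SE]].
  rewrite setU11 /=; apply/eqP/idP => [<-|]; last exact: setU1K.
  by rewrite !inE eqxx.
have iS : i \notin S by rewrite -SE !inE eqxx.
rewrite !mulrA product_weightU1 // gi.
by suff -> : S :\ i = S by []; rewrite -{1}SE setDDl setUid.
Qed.

Lemma sum_product_weight_notin x i g : (forall S, g (i |: S) = g (S :\ i)) ->
  \sum_(S : {set X} | i \notin S) product_weight x S * g S =
  (1 - x i) * \sum_S product_weight x S * g S.
Proof.
move=> gi; rewrite mulrBl mul1r -sum_product_weight_mem //; apply/eqP.
by rewrite -subr_eq opprK [eqbRHS](bigID (fun S : {set X} => i \in S)) addrC.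
Qed.

Lemma product_weight_marginal x i :
  \sum_(S : {set X} | i \in S) product_weight x S = x i.
Proof.
have := @sum_product_weight_mem x i (fun=> 1) (fun=> erefl).
by rewrite -!mulr_suml !mulr1 sum_product_weight mulr1.
Qed.

End ProductDistribution.

(** * Submodular inequalities and the first-order bound on the extension *)

Section Submodular.
Context {R : realType} {X : finType}.
Implicit Types (f g w : {set X} -> R) (x : X -> R) (S T U O : {set X}).

Lemma submodular_setC f : submodular f -> submodular (fun S => f (~: S)).
Proof. by move=> fs S T; rewrite setCU setCI addrC. Qed.

Lemma submodular_setU f O : submodular f -> submodular (fun S => f (O :|: S)).
Proof.
by move=> fs S T; have := fs (O :|: S) (O :|: T); rewrite -setUIr -setUUr.
Qed.

Lemma submodular_setI f O : submodular f -> submodular (fun S => f (O :&: S)).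
Proof.
by move=> fs S T; have := fs (O :&: S) (O :&: T); rewrite -setIUr -setIIr.
Qed.

(* No independence is needed: [\sum_S w S * g S] dominates the Lovasz extension
   of [g] at the marginals [m].  The induction removes from [U] its element [i]
   of least marginal, which changes the bound by [m i * (g U - g (U :\ i))]. *)
Lemma submodular_expectation_ge w g (q : R) :
  (forall S, 0 <= w S) -> (forall S, 0 <= g S) -> submodular g -> 0 <= q ->
  (forall i, \sum_(S : {set X} | i \in S) w S <= q) ->
  (\sum_S w S - q) * g set0 <= \sum_S w S * g S.
Proof.
move=> w0 g0 gs q0 mq; pose m i := \sum_(S : {set X} | i \in S) w S.
(* [mu] is a common lower bound on the marginals over [U]: it starts at 0, rises to the least
   marginal [m i] at each removal, and at [U = set0] is absorbed by [mu <= q]. *)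
suff main n U mu : (#|U| < n)%N -> mu <= q -> (forall i, i \in U -> mu <= m i) ->
    (\sum_S w S - q) * g set0 + mu * g U <= \sum_S w S * g (S :&: U).
  have := main #|X|.+1 [set: X] 0; rewrite mul0r addr0.
  have -> : \sum_S w S * g (S :&: [set: X]) = \sum_S w S * g S.
    by apply: eq_bigr => S _; rewrite setIT.
  apply=> //; first by rewrite ltnS max_card.
  by move=> i _; apply: sumr_ge0.
elim: n U mu => // n IH U mu ltUn muq mum.
have [->|[i0 i0U]] := set_0Vmem U.
  have -> : \sum_S w S * g (S :&: set0) = (\sum_S w S) * g set0.
    by rewrite mulr_suml; apply: eq_bigr => S _; rewrite setI0.
  by rewrite -mulrDl ler_wpM2r // -lerBrDl opprB addrC subrK.
have [i iU mi] : exists2 i, i \in U & forall j, j \in U -> m i <= m j.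
  by case: (Order.TotalTheory.arg_minP m i0U) => i iU mi; exists i.
apply: (@le_trans _ _ (\sum_S w S * g (S :&: (U :\ i)) + m i * (g U - g (U :\ i)))).
  have IHi : (\sum_S w S - q) * g set0 + m i * g (U :\ i)
      <= \sum_S w S * g (S :&: (U :\ i)).
    apply: IH; [|exact: mq|by move=> j /setD1P[_ /mi]].
    by move: ltUn; rewrite (cardsD1 i U) iU.
  have : mu * g U <= m i * g U by rewrite ler_wpM2r ?mum.
  by move: IHi; rewrite mulrBr; lra.
rewrite /m mulr_suml [X in _ + X]big_mkcond /= -big_split /=.
(* If [i \in S], submodularity is applied to [S :&: U] and [U :\ i]; otherwise removing [i] does not
   change the intersection with [S]. *)
apply: ler_sum => S _; case: ifP => iS; rewrite -?mulrDr ?addr0 ler_wpM2l //.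
  have := gs (S :&: U) (U :\ i).
  have -> : (S :&: U) :|: (U :\ i) = U.
    apply/setP => j; rewrite !inE; case: eqP => [->|_]; first by rewrite iS iU.
    by case: (j \in S); case: (j \in U).
  have -> : (S :&: U) :&: (U :\ i) = S :&: (U :\ i).
    by apply/setP => j; rewrite !inE; case: (j != i); case: (j \in S); case: (j \in U).
  by lra.
suff -> : S :&: (U :\ i) = S :&: U by [].
by apply/setP => j; rewrite !inE; case: eqP => [->|_]; rewrite ?iS.
Qed.

(** Diminishing returns: each element of [T] gains at most as much on top of a superset of [S] as on
    [S] itself. *)
Lemma submodular_setU_le f S T : submodular f ->
  f (S :|: T) - f S <= \sum_(i in T) (f (i |: S) - f S).
Proof.
move=> fs; have [n] := ubnP #|T|; elim: n T => // n IH T ltTn.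
have [->|[a aT]] := set_0Vmem T; first by rewrite setU0 subrr big_set0.
rewrite (big_setD1 a) //=.
have IHa : f (S :|: T :\ a) - f S <= \sum_(i in T :\ a) (f (i |: S) - f S).
  by apply: IH; move: ltTn; rewrite (cardsD1 a T) aT.
have := fs (S :|: T :\ a) (a |: S).
have -> : (S :|: T :\ a) :|: (a |: S) = S :|: T.
  apply/setP => j; rewrite !inE; case: eqP => [->|_]; first by rewrite aT !orbT.
  by case: (j \in S); case: (j \in T).
have -> : (S :|: T :\ a) :&: (a |: S) = S.
  apply/setP => j; rewrite !inE; case: eqP => [->|_].
    by case: (a \in S).
  by case: (j \in S); case: (j \in T).
by lra.
Qed.

Lemma submodular_setD_le f S T : submodular f ->
  f (S :\: T) - f S <= \sum_(i in T) (f (S :\ i) - f S).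
Proof.
move=> fs; have := submodular_setU_le (~: S) T (submodular_setC fs).
rewrite setCU !setCK -setDE; congr (_ <= _).
by apply: eq_bigr => i _; rewrite setCU setCK setIC -setDE.
Qed.

(** The partial derivative of the multilinear extension. [F] is affine in [x i], so this is its
    value at [x i = 1] minus that at [x i = 0]; the factor for [i] in the weight sums out. *)
Definition multilinear_deriv f x i : R :=
  \sum_S product_weight x S * (f (i |: S) - f (S :\ i)).

Lemma sum_product_weight_add f x i :
  \sum_S product_weight x S * (f (i |: S) - f S) =
  (1 - x i) * multilinear_deriv f x i.
Proof.
rewrite -sum_product_weight_notin; last first.
  by move=> S; congr (f _ - f _); apply/setP => j; rewrite !inE; case: eqP.
rewrite [RHS]big_mkcond; apply: eq_bigr => S _ /=; case: ifPn => [iS|].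
  by congr (_ * (_ - f _)); apply/setP => j; rewrite !inE; case: eqP => [->|//]; apply/negbTE.
by rewrite negbK => iS; rewrite (setUidPr _) ?sub1set // subrr mulr0.
Qed.

Lemma sum_product_weight_remove f x i :
  \sum_S product_weight x S * (f (S :\ i) - f S) =
  - (x i * multilinear_deriv f x i).
Proof.
rewrite -sum_product_weight_mem; last first.
  by move=> S; congr (f _ - f _); apply/setP => j; rewrite !inE; case: eqP.
rewrite -sumrN [RHS]big_mkcond; apply: eq_bigr => S _ /=; case: ifPn => iS.
  by rewrite (setUidPr _) ?sub1set // -mulrN opprB.
suff -> : S :\ i = S by rewrite subrr mulr0.
by apply/setP => j; rewrite !inE; case: eqP => [->|//]; rewrite (negbTE iS).
Qed.

(** Reaching [O :|: S] inserts elements of [O], and reaching [O :&: S] deletes elements of [~: O].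
    The expected single-element changes are [1 - x i] and [- x i] times the derivative, which are
    the coefficients of [indicator O - x]. *)
Lemma multilinear_setUI_le f x O : submodular f ->
  (forall i, 0 <= x i) -> (forall i, x i <= 1) ->
  \sum_S product_weight x S * f (O :|: S) + \sum_S product_weight x S * f (O :&: S)
  <= 2 * multilinear f x
     + \sum_i (indicator O i - x i) * multilinear_deriv f x i.
Proof.
move=> fs x0 x1.
have w0 S : 0 <= product_weight x S by apply: product_weight_ge0.
have leU : \sum_S product_weight x S * (f (O :|: S) - f S) <=
    \sum_(i in O) (1 - x i) * multilinear_deriv f x i.
  under [leRHS]eq_bigr do rewrite -sum_product_weight_add.
  rewrite exchange_big /=; apply: ler_sum => S _.
  by rewrite -mulr_sumr ler_wpM2l // setUC submodular_setU_le.
have leI : \sum_S product_weight x S * (f (O :&: S) - f S) <=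
    \sum_(i in ~: O) - (x i * multilinear_deriv f x i).
  under [leRHS]eq_bigr do rewrite -sum_product_weight_remove.
  rewrite exchange_big /=; apply: ler_sum => S _.
  by rewrite -mulr_sumr ler_wpM2l // setIC -[O in S :&: O]setCK -setDE submodular_setD_le.
have -> : \sum_i (indicator O i - x i) * multilinear_deriv f x i =
    \sum_(i in O) (1 - x i) * multilinear_deriv f x i +
    \sum_(i in ~: O) - (x i * multilinear_deriv f x i).
  rewrite [LHS](bigID (mem O)) /=; congr (_ + _).
    by apply: eq_bigr => i iO; rewrite /indicator iO.
  apply: eq_big => [i|i /negbTE iO]; first by rewrite inE.
  by rewrite /indicator iO sub0r mulNr.
move: leU leI; rewrite !multilinearE.
under eq_bigr do rewrite mulrBr.
under [X in _ -> X <= _ -> _]eq_bigr do rewrite mulrBr.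
by rewrite !sumrB; lra.
Qed.

End Submodular.

(** * Averaging over the group, and bounds on the center *)

Section Symmetrization.
Context {R : realType} {X : finType} (G : {group {perm X}}).
Implicit Types (f : {set X} -> R) (F : {set {set X}}) (x c : X -> R) (q : R).

Let cardG_neq0 : #|G|%:R != 0 :> R.
Proof. by rewrite pnatr_eq0 -lt0n cardG_gt0. Qed.

Lemma symmetrization_le x q i :
  (forall j, x j <= q) -> symmetrization G x i <= q.
Proof.
move=> xq; rewrite -[leRHS](mulKf cardG_neq0) ler_wpM2l ?invr_ge0 ?ler0n //.
by rewrite mulr_natl -sumr_const; apply: ler_sum => s _; apply: xq.
Qed.

Lemma symmetrization_ge x q i :
  (forall j, q <= x j) -> q <= symmetrization G x i.
Proof.
move=> xq; rewrite -[leLHS](mulKf cardG_neq0) ler_wpM2l ?invr_ge0 ?ler0n //.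
by rewrite mulr_natl -sumr_const; apply: ler_sum => s _; apply: xq.
Qed.

Lemma symmetrization_perm x (s : {perm X}) i :
  s \in G -> symmetrization G x (s i) = symmetrization G x i.
Proof.
move=> sG; congr (_ * _); rewrite (reindex_inj (mulIg s)) /=.
apply: eq_big => [t|t _]; first by rewrite groupMr.
by rewrite /permute_point invMg permM permK.
Qed.

Lemma multilinear_deriv_perm f x (s : {perm X}) i :
  (forall S : {set X}, f (s @: S) = f S) -> (forall j, x (s j) = x j) ->
  multilinear_deriv f x (s i) = multilinear_deriv f x i.
Proof.
move=> fs xs; rewrite /multilinear_deriv (reindex_inj (imset_inj (@perm_inj _ s))) /=.
apply: eq_bigr => S _; congr (_ * (_ - _)).
- rewrite /product_weight (reindex_inj (@perm_inj _ s)) /=.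
  by apply: eq_bigr => j _; rewrite (mem_imset _ _ perm_inj) xs.
- by rewrite -imset_set1 -imsetU fs.
- rewrite -[RHS]fs; congr (f _); apply/setP => j; rewrite -(permKV s j).
  by rewrite !inE !(mem_imset _ _ perm_inj) !inE (inj_eq perm_inj).
Qed.

(** Since [d] is constant on orbits, every permuted copy of [x] has the same inner product with [d],
    hence so does their average. *)
Lemma symmetrization_stationary (d x : X -> R) :
  (forall (s : {perm X}) i, s \in G -> d (s i) = d i) ->
  \sum_i (x i - symmetrization G x i) * d i = 0.
Proof.
move=> dG; under eq_bigr do rewrite mulrBl.
apply/eqP; rewrite sumrB subr_eq0; apply/eqP.
under [RHS]eq_bigr do rewrite -mulrA mulr_suml.
rewrite -mulr_sumr exchange_big /=.
rewrite [in RHS](eq_bigr (fun=> \sum_i x i * d i)); last first.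
  move=> s sG; rewrite (reindex_inj (@perm_inj _ s)) /=.
  by apply: eq_bigr => i _; rewrite /permute_point permK dG.
by rewrite sumr_const -[X in _ * X]mulr_natl mulKf.
Qed.

Lemma in_polytope_ge0 F x i : in_polytope F x -> 0 <= x i.
Proof.
by move=> [lam [lam0 _ ->]]; apply: sumr_ge0 => S SF; rewrite mulr_ge0 ?lam0 ?ler0n.
Qed.

Lemma in_polytope_le1 F x i : in_polytope F x -> x i <= 1.
Proof.
move=> [lam [lam0 <- ->]]; apply: ler_sum => S SF.
by rewrite ler_piMr ?lam0 // lern1 leq_b1.
Qed.

Lemma indicator_in_polytope F S : S \in F -> in_polytope F (@indicator R X S).
Proof.
move=> SF; exists (fun T => (T == S)%:R); split=> [T _| |i]; first exact: ler0n.
  rewrite (bigD1 S) //= eqxx big1 ?addr0 // => T /andP[_ /negbTE ->] //.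
rewrite (bigD1 S) //= eqxx mul1r big1 ?addr0 // => T /andP[_ /negbTE ->].
by rewrite mul0r.
Qed.

Lemma center_packing_le1 f F c (alpha : {set X} -> R) i :
  totally_symmetric f F G c -> fractional_packing F alpha ->
  (\sum_(B in F) alpha B) * c i <= 1.
Proof.
move=> [_ _ cP csym] [alpha0 alpha1]; set a := \sum_(B in F) alpha B.
have : 0 <= a by apply: sumr_ge0.
rewrite le_eqVlt => /predU1P[<-|a0]; first by rewrite mul0r.
rewrite mulrC -ler_pdivlMr // mul1r.
pose x j := \sum_(S in F) (alpha S / a) * indicator S j.
rewrite (csym x); last first.
  exists (fun S => alpha S / a); split=> // [S SF|].
    by rewrite divr_ge0 ?alpha0 // ltW.
  by rewrite -mulr_suml divff // gt_eqF.
apply: symmetrization_le => j; rewrite -[leRHS]mul1r ler_pdivlMr //.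
apply: le_trans (alpha1 j); rewrite /x mulr_suml big_mkcondr /=.
apply: ler_sum => S SF; rewrite /indicator mulrAC divfK ?gt_eqF //.
by case: (j \in S); rewrite ?mulr1 ?mulr0.
Qed.

(** Moving the normalized weights from complements back to [F] gives a point with coordinates at
    least [1 - 1 / a]. *)
Lemma center_copacking_le1 f F c (alpha : {set X} -> R) i :
  totally_symmetric f F G c ->
  fractional_packing [set ~: B | B in F] alpha ->
  (\sum_(B in [set ~: B | B in F]) alpha B) * (1 - c i) <= 1.
Proof.
move=> [_ _ cP csym] [alpha0 alpha1]; set a := \sum_(B in _) alpha B.
have : 0 <= a by apply: sumr_ge0.
rewrite le_eqVlt => /predU1P[<-|a0]; first by rewrite mul0r.
rewrite mulrC -ler_pdivlMr // mul1r lerBlDr addrC -lerBlDr.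
have sumC (h : {set X} -> R) (P : pred {set X}) :
    \sum_(S in [set ~: B | B in F] | P S) h S = \sum_(S in F | P (~: S)) h (~: S).
  rewrite (reindex_inj (inv_inj (@setCK X))) /=.
  by apply: eq_bigl => S; rewrite (mem_imset _ _ (inv_inj (@setCK X))).
pose x j := \sum_(S in F) (alpha (~: S) / a) * indicator S j.
have sum1 : \sum_(S in F) alpha (~: S) / a = 1.
  rewrite -mulr_suml; have := sumC alpha xpredT.
  under eq_bigl do rewrite andbT.
  under [in RHS]eq_bigl do rewrite andbT.
  by rewrite -/a => <-; rewrite divff // gt_eqF.
rewrite (csym x); last first.
  exists (fun S => alpha (~: S) / a); split=> // S SF.
  by rewrite divr_ge0 ?alpha0 ?ltW // mem_imset //; apply: (inv_inj (@setCK X)).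
apply: symmetrization_ge => j; rewrite lerBlDr -lerBlDl -{1}sum1 /x -sumrB.
rewrite -[leRHS]mul1r ler_pdivlMr //; apply: le_trans (alpha1 j).
rewrite sumC mulr_suml big_mkcondr /=.
apply: ler_sum => S SF; rewrite /indicator inE.
by case: (j \in S); rewrite ?mulr1 ?mulr0 ?subrr ?subr0 ?mul0r ?divfK ?gt_eqF.
Qed.

End Symmetrization.

(** * Inverting the extended-real packing number *)

Lemma fractional_packing_number_ge1 (R : realType) (X : finType) (F : {set {set X}})
    (B : {set X}) : B \in F -> (1 <= fractional_packing_number R F)%E.
Proof.
move=> BF; have sumB (P : pred {set X}) :
    \sum_(S in F | P S) (S == B)%:R = (P B)%:R :> R.
  rewrite big_mkcondr (bigD1 B) //= eqxx big1 ?addr0; first by case: (P B).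
  by move=> S /andP[_ /negbTE ->]; case: (P S).
apply: ereal_sup_ubound; exists (fun S => (S == B)%:R).
  by split=> [S _|j]; rewrite ?ler0n // sumB lern1 leq_b1.
have := sumB xpredT; under eq_bigl do rewrite andbT.
by move=> ->.
Qed.

(** The real [p] stands for [1 / nu], read as 0 when [nu] is infinite, so that the remaining
    argument is over the reals. *)
Lemma fractional_packing_number_inv (R : realType) (X : finType) (F : {set {set X}})
    (B : {set X}) : B \in F ->
  exists p : R, [/\ 0 <= p,
    ((2%:E * fractional_packing_number R F)^-1 = (p / 2)%:E)%E &
    forall t, 0 <= t ->
      (forall alpha, fractional_packing F alpha -> (\sum_(S in F) alpha S) * t <= 1) ->
      t <= p].
Proof.
move=> BF; set nu := fractional_packing_number R F.
have nu1 : (1 <= nu)%E := fractional_packing_number_ge1 R BF.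
have nut t : 0 < t ->
    (forall alpha, fractional_packing F alpha -> (\sum_(S in F) alpha S) * t <= 1) ->
    (nu <= (t^-1)%:E)%E.
  move=> t0 ht; apply: ge_ereal_sup => _ [alpha pa <-].
  by rewrite lee_fin -[leRHS]mul1r ler_pdivlMr // ht.
move: nu1 nut; case: nu => [r| |] // nu1 nut.
  have r0 : 0 < r by apply: lt_le_trans ltr01 _; rewrite -lee_fin.
  exists r^-1; split=> [| |t].
  - by rewrite invr_ge0 ltW.
  - by rewrite -EFinM inver mulf_eq0 pnatr_eq0 /= (gt_eqF r0) invfM mulrC.
  - rewrite le_eqVlt => /predU1P[<- _|t0 ht]; first by rewrite invr_ge0 ltW.
    by have := nut t t0 ht; rewrite lee_fin => rt; rewrite -[t]invrK lef_pV2 // posrE invr_gt0.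
(* Here [nu] is infinite: a positive [t] would force [nu] below the finite [t^-1]. *)
exists 0; split=> // [|t].
  by rewrite gt0_muley ?lte_fin ?ltr0n // invey mul0r.
by rewrite le_eqVlt => /predU1P[<- //|t0 ht]; have := nut t t0 ht.
Qed.

Theorem theorem5p8 (R : realType) (X : finType) (M : matroid X)
    (f : {set X} -> R) (G : {group {perm X}}) (c : X -> R)
    (f_ge0 : forall S : {set X}, 0 <= f S)
    (f_submod : submodular f)
    (symm : totally_symmetric f (bases M) G c) :
  let nu := fractional_packing_number R (bases M) in
  let nustar := fractional_packing_number R (bases (dual_matroid M)) in
  ((1 - (2%:E * nu)^-1 - (2%:E * nustar)^-1) * (OPT f (bases M))%:E
     <= (multilinear f c)%:E)%E.
Proof.
rewrite /= bases_dual.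
have [B0 B0M _] := indep_bases_ex (indep0 M).
have [p [p0 -> cp]] := fractional_packing_number_inv R B0M.
have [q [q0 -> cq]] := fractional_packing_number_inv R (imset_f (@setC X) B0M).
have [fG _ cP csym] := symm.
have c0 i : 0 <= c i := in_polytope_ge0 i cP.
have c1 i : c i <= 1 := in_polytope_le1 i cP.
have {}cp i : c i <= p by apply: cp => // alpha /(center_packing_le1 i symm).
have {}cq i : 1 - c i <= q.
  by apply: cq; rewrite ?subr_ge0 // => alpha /(center_copacking_le1 i symm).
have [O OM ->] : exists2 O, O \in bases M & OPT f (bases M) = f O.
  have [O OM OE] := @eq_bigmax _ _ _ 0 B0 (mem (bases M)) f B0M (fun S _ => f_ge0 S).
  by exists O.
rewrite -!EFinB -EFinM lee_fin.
have w0 S : 0 <= product_weight c S by apply: product_weight_ge0.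
have leU : (1 - p) * f O <= \sum_S product_weight c S * f (O :|: S).
  have := submodular_expectation_ge w0 (fun S => f_ge0 (O :|: S))
    (submodular_setU O f_submod) p0.
  rewrite sum_product_weight setU0; apply=> i.
  by rewrite product_weight_marginal.
have leI : (1 - q) * f O <= \sum_S product_weight c S * f (O :&: S).
  (* The summation variable is now the complement of the sample: it contains [i] with probability
     [1 - c i <= q], and the function has value [f O] at [set0]. *)
  have := submodular_expectation_ge (w := fun S => product_weight c (~: S))
    (g := fun S => f (O :&: ~: S)) (fun S => w0 _) (fun S => f_ge0 _)
    (submodular_setC (submodular_setI O f_submod)) q0.
  rewrite setC0 setIT.
  have sumC (h : {set X} -> R) : \sum_(S : {set X}) h (~: S) = \sum_S h S.
    by rewrite [RHS](reindex_inj (inv_inj (@setCK X))).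
  rewrite (sumC (product_weight c)) (sumC (fun S => _ S * f (O :&: S))).
  rewrite sum_product_weight; apply=> i.
  rewrite (reindex_inj (inv_inj (@setCK X))) /=.
  under eq_bigl do rewrite inE; under eq_bigr do rewrite setCK.
  have := @sum_product_weight_notin R X c i (fun=> 1) (fun=> erefl).
  by rewrite -!mulr_suml !mulr1 sum_product_weight mulr1 => ->.
have cE : c =1 symmetrization G (indicator O) by apply/csym/indicator_in_polytope.
have := multilinear_setUI_le O f_submod c0 c1.
(* Only the [c] in the difference becomes an average of images of [indicator O]; the derivatives
   stay at [c], where they are [G]-invariant because [f] and [c] are. *)
under [X in _ <= _ + X]eq_bigr do rewrite {1}cE.
rewrite symmetrization_stationary; last first.
  move=> s i sG; apply: multilinear_deriv_perm => [S|j]; first exact: fG.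
  by rewrite !cE symmetrization_perm.
move: leU leI; rewrite !mulrBl !mul1r.
by lra.
Qed.
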